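(* Let $\rho\in(\varepsilon/2,\varepsilon)$. Let the data-generating distribution $\mathbb{P}_0$ of $(\tilde\xi_1,\tilde\xi_2)$ be the two-point distribution with $\mathbb{P}_0[(\tilde\xi_1,\tilde\xi_2)=(1,-1)]=\rho$ and $\mathbb{P}_0[(\tilde\xi_1,\tilde\xi_2)=(-1,1)]=1-\rho$. Consider the distributionally robust chance constrained program $$(\star)\qquad\min_{x\in\mathbb{R}}\; x\quad\text{s.t.}\quad \mathbb{P}[x>\tilde\xi_1,\;x<\tilde\xi_2]\ge 1-\varepsilon\;\;\forall\mathbb{P}\in\mathcal{F}(\theta),\quad 0\le x\le 1.$$ Then, as $N\to\infty$, with probability going to $1$: (i) the ALSO-X approximation of $(\star)$ becomes exact; (ii) the worst-case CVaR approximation of $(\star)$, which replaces the joint chance constraint with $$\sup_{\mathbb{P}\in\mathcal{F}(\theta)}\mathbb{P}\text{-CVaR}_\varepsilon\big(\max\{w_1(\tilde\xi_1-x),\,w_2(x-\tilde\xi_2)\}\big)\le 0,$$ becomes infeasible for any choice of scaling factors $(w_1,w_2)\in\Delta^2_{++}$.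
   Context: Risk threshold $\varepsilon\in(0,1)$. The samples $\hat{\boldsymbol{\xi}}_1,\dots,\hat{\boldsymbol{\xi}}_N\in\mathbb{R}^2$ are drawn independently from $\mathbb{P}_0$; ''with probability going to $1$'' refers to the sampling. $\hat{\mathbb{P}}=\frac1N\sum_{i=1}^N\delta_{\hat{\boldsymbol{\xi}}_i}$ is the empirical distribution and $\mathcal{F}(\theta)=\{\mathbb{P}\in\mathcal{P}(\mathbb{R}^2) : d_{\rm W}(\mathbb{P},\hat{\mathbb{P}})\le\theta\}$, where $\mathcal{P}(\mathbb{R}^2)$ is the set of probability distributions on $\mathbb{R}^2$ and $d_{\rm W}(\mathbb{P}_1,\mathbb{P}_2)$ is the type-1 Wasserstein distance (infimum of $\mathbb{E}[\|\tilde{\boldsymbol{\xi}}-\tilde{\boldsymbol{\xi}}'\|]$ over all joint distributions with marginals $\mathbb{P}_1,\mathbb{P}_2$) for a $p$-norm $\|\cdot\|$ with $p\in\mathbb{Q}$, $p>1$. The radius $\theta=\theta_N>0$ satisfies $\theta_N\to0$ as $N\to\infty$, and the probability that $\mathbb{P}_0\in\mathcal{F}(\theta_N)$ tends to one as $N\to\infty$. $\mathbb{P}\text{-CVaR}_\varepsilon(\ell(\tilde{\boldsymbol{\xi}}))=\inf\{\tau+\mathbb{E}_{\mathbb{P}}[(\ell(\tilde{\boldsymbol{\xi}})-\tau)^+]/\varepsilon : \tau\in\mathbb{R}\}$ with $(y)^+=\max\{y,0\}$, and $\Delta^2_{++}=\{\boldsymbol{w}\in(0,1)^2 : w_1+w_2=1\}$.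 ALSO-X approximation: for a problem minimizing $c\,x$ over $x\in\mathcal{X}$ subject to $\sup_{\mathbb{P}\in\mathcal{F}(\theta)}\mathbb{P}[g(x,\tilde{\boldsymbol{\xi}})\ge0]\le\varepsilon$, let, for each $\delta$ for which the following problem is feasible, $x^\star(\delta)$ be an (arbitrarily chosen) minimizer of $\sup_{\mathbb{P}\in\mathcal{F}(\theta)}\mathbb{E}_{\mathbb{P}}[(g(x,\tilde{\boldsymbol{\xi}}))^+]$ over $\{x\in\mathcal{X} : c\,x\le\delta\}$. ALSO-X determines the smallest $\delta$ for which $x^\star(\delta)$ satisfies $\sup_{\mathbb{P}\in\mathcal{F}(\theta)}\mathbb{P}[g(x^\star(\delta),\tilde{\boldsymbol{\xi}})\ge0]\le\varepsilon$ and returns the corresponding $x^\star(\delta)$. For $(\star)$, $\mathcal{X}=[0,1]$, $c=1$ and $g(x,\boldsymbol{\xi})=\max\{\xi_1-x,\,x-\xi_2\}$. ALSO-X is exact if the solution it returns is optimal in $(\star)$. The worst-case CVaR approximation is infeasible if no $x\in[0,1]$ satisfies its constraint. *)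

(* Defs.v *)
From HB Require Import structures.
From mathcomp Require Import all_boot all_order all_algebra.
From mathcomp Require Import all_classical all_reals all_analysis.

Set Implicit Arguments.
Unset Strict Implicit.
Unset Printing Implicit Defensive.

Import Order.TTheory GRing.Theory Num.Theory.
Import numFieldNormedType.Exports.

Local Open Scope classical_set_scope.
Local Open Scope ring_scope.

(* The inner formulation (a measurable subevent of probability tending to 1)
   makes sense whether or not the sets A N are themselves measurable; when they
   are, it is equivalent to Pr (A N) --> 1. *)
Definition with_prob_to_1 (R : realType) (d : measure_display)
    (Omega : measurableType d) (Pr : probability Omega R)
    (A : nat -> set Omega) : Prop :=
  exists E : nat -> set Omega,
    [/\ forall N, measurable (E N),
        forall N, E N `<=` A N
      & Pr (E N) @[N --> \oo] --> 1%E].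

(* Mutual independence: product rule over every finite subfamily, the indices
   of which are enumerated by s. *)
Definition iid_samples (R : realType) (d d' : measure_display)
    (Omega : measurableType d) (T : measurableType d')
    (Pr : probability Omega R) (P0 : probability T R)
    (xi : nat -> {mfun Omega >-> T}) : Prop :=
  (forall (i : nat) (A : set T), measurable A ->
     distribution Pr (xi i) A = P0 A) /\
  (forall (s : seq nat) (A : nat -> set T), uniq s ->
     (forall i, measurable (A i)) ->
     Pr (\bigcap_(i in [set` s]) xi i @^-1` A i) =
     (\prod_(i <- s) Pr (xi i @^-1` A i))%E).

Section wasserstein.
Context {R : realType}.

Definition pnorm (p : R) (z : R * R) : R :=
  (`|z.1| `^ p + `|z.2| `^ p) `^ p^-1.

Definition is_coupling (P1 P2 : {measure set (R * R) -> \bar R})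
    (Q : probability ((R * R) * (R * R))%type R) : Prop :=
  forall A : set (R * R), measurable A ->
    Q (A `*` setT) = P1 A /\ Q (setT `*` A) = P2 A.

Definition wasserstein (p : R) (P1 P2 : {measure set (R * R) -> \bar R})
    : \bar R :=
  ereal_inf [set (\int[Q]_u (pnorm p (u.1 - u.2))%:E)%E
            | Q in is_coupling P1 P2].

(* The empirical distribution of the samples xi 0, ..., xi (N - 1)
   (the null measure for the junk value N = 0). *)
Definition empirical (xi : nat -> R * R) (N : nat)
    : {measure set (R * R) -> \bar R} :=
  mscale (N%:R^-1)%:nng (msum (fun i => \d_(xi i)) N).

Definition ambiguity_set (p : R) (xi : nat -> R * R) (N : nat) (theta : R)
    : set (probability (R * R)%type R) :=
  [set P | (wasserstein p P (empirical xi N) <= theta%:E)%E].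

End wasserstein.

Section risk.
Context {R : realType}.
Implicit Types F : set (probability (R * R)%type R).

Definition worst_prob F (A : set (R * R)) : \bar R :=
  ereal_sup [set P A | P in F].

Definition worst_expectation F (f : R * R -> R) : \bar R :=
  ereal_sup [set (\int[P]_z (f z)%:E)%E | P in F].

Definition cvar (eps : R) (P : probability (R * R)%type R) (l : R * R -> R)
    : \bar R :=
  ereal_inf [set (tau%:E +
                  (\int[P]_z (Num.max (l z - tau)%R 0%R)%:E) * (eps^-1)%:E)%E
            | tau in [set: R]].

Definition worst_cvar (eps : R) F (l : R * R -> R) : \bar R :=
  ereal_sup [set cvar eps P l | P in F].

End risk.

Definition is_minimizer (disp : Order.disp_t) (U : Type) (V : porderType disp)
    (f : U -> V) (A : set U) (x : U) : Prop :=
  A x /\ forall y, A y -> (f x <= f y)%O.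

Section alsox.
Context {R : realType}.
Variables (F : set (probability (R * R)%type R)) (X : set R) (c : R)
  (g : R -> R * R -> R) (eps : R).

Definition alsox_region (delta : R) : set R := X `&` [set x | c * x <= delta].

Definition alsox_objective (x : R) : \bar R :=
  worst_expectation F (fun z => Num.max (g x z) 0).

Definition alsox_selection (xs : R -> R) : Prop :=
  forall delta, alsox_region delta !=set0 ->
    is_minimizer alsox_objective (alsox_region delta) (xs delta).

Definition alsox_accepted (xs : R -> R) : set R :=
  [set delta | alsox_region delta !=set0 /\
     (worst_prob F [set z | (0 <= g (xs delta) z)%R] <= eps%:E)%E].

(* x is the point returned when the minimizers are chosen according to xs *)
Definition alsox_returns (xs : R -> R) (x : R) : Prop :=
  exists delta, is_minimizer id (alsox_accepted xs) delta /\ x = xs delta.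

(* Exactness with respect to a set opt of optimal solutions: the auxiliary
   problems admit minimizers, and whichever minimizers are chosen, a point is
   returned and it is optimal. *)
Definition alsox_exact (opt : set R) : Prop :=
  (exists xs, alsox_selection xs) /\
  (forall xs, alsox_selection xs -> exists x, alsox_returns xs x /\ opt x).

End alsox.

Section star.
Context {R : realType}.
Variables (eps : R) (F : set (probability (R * R)%type R)).

Definition star_feasible : set R :=
  [set x | 0 <= x <= 1 /\
     forall P, F P -> ((1 - eps)%:E <= P [set z | (z.1 < x)%R /\ (x < z.2)%R])%E].

Definition star_optimal : set R := is_minimizer id star_feasible.

Definition star_g (x : R) (z : R * R) : R := Num.max (z.1 - x) (x - z.2).

Definition star_alsox_exact : Prop :=
  alsox_exact F [set x | 0 <= x <= 1] 1 star_g eps star_optimal.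

Definition star_cvar_feasible (w : R * R) : set R :=
  [set x | 0 <= x <= 1 /\
     (worst_cvar eps F
        (fun z => Num.max (w.1 * (z.1 - x))%R (w.2 * (x - z.2))%R)
      <= 0)%E].

End star.

Definition simplex2pp (R : realType) : set (R * R) :=
  [set w | [/\ 0 < w.1 < 1, 0 < w.2 < 1 & w.1 + w.2 = 1]].

(* Main.v *)
Require Import Defs.
From HB Require Import structures.
From mathcomp Require Import all_boot all_order all_algebra.
From mathcomp Require Import all_classical all_reals all_analysis.
From mathcomp Require Import measurable_realfun.
From mathcomp Require Import ring lra.
Import Order.TTheory GRing.Theory Num.Theory.
Import numFieldNormedType.Exports.
Local Open Scope classical_set_scope.
Local Open Scope ring_scope.

(** Write [r] for the fraction of samples equal to the bad point [(1, -1)];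
    the other samples, almost surely, are the good point [(-1, 1)], so the
    empirical distribution is the two-point law with weights [r] and [1 - r].
    Everything below is deterministic once the samples lie on these two points
    and the true distribution belongs to the ball.

    The ball is controlled from above by the easy half of Kantorovich duality
    (wasserstein_weak_duality): if [f u <= g v + |u - v|] for all [u] and [v],
    then a distribution within [theta] of the centre gives [f] an expectation at
    most [theta] above the one that the centre gives [g]. Applied to indicators
    (wasserstein_prob_le), this bounds the mass that can have travelled a
    distance at least 1. Since the good and the bad point are that far apart,
    membership of the true distribution in the ball forces
    [|r - rho| <= theta]. Since the good point is at distance 1 from the
    violating region of [x = 0], that region has worst-case probability at most
    [r + theta], eventually below [eps] because [rho < eps].

    For ALSO-X, the loss [max (star_g x z) 0] is 1-Lipschitz in [z], with value
    [1 + x] at the bad point and 0 at the good point, so its worst-case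
    expectation is at most [r (1 + x) + theta]. Moving the mass [r] from the bad
    point by [theta / r] along the second axis attains this bound. As [r > 0],
    [x = 0] is the only minimizer over every nonempty region; it meets the
    chance constraint, and it is optimal because [x] cannot be negative.

    For the CVaR approximation, the true distribution is itself a member of the
    ball that violates the constraint: as [rho <= eps], its CVaR is at least
    [(rho * l bad + (eps - rho) * l good) / eps], and bounding both losses by
    their [w.2] terms leaves at least [w.2 * (2 * rho - eps) / eps > 0] for
    every [x] in [[0, 1]] and all weights. *)

(** * Two-point distributions *)

Definition pick2 {T : Type} (a b : T) (c : bool) : T := if c then a else b.

Section pick2_measurable.
Context {d : measure_display} {T : measurableType d} (a b : T).

Let measurable_pick2 : measurable_fun setT (pick2 a b).
Proof. by move=> _ A _. Qed.

HB.instance Definition _ := isMeasurableFun.Build _ _ _ _ (pick2 a b)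
  measurable_pick2.

End pick2_measurable.

(** A pushforward of a Bernoulli law, so that a coupling of two such
    distributions is again one of them, on pairs of points. *)
Definition two_point {R : realType} {d : measure_display}
    {T : measurableType d} (r : R) (a b : T) : probability T R :=
  distribution (bernoulli_prob r) (pick2 a b).

Lemma two_pointE {R : realType} {d : measure_display} {T : measurableType d}
    (r : R) (a b : T) (A : set T) : 0 <= r <= 1 ->
  two_point r a b A = (r * \1_A a + (1 - r) * \1_A b)%:E.
Proof.
move=> r01; have -> : two_point r a b A = bernoulli_prob r (pick2 a b @^-1` A).
  by [].
by rewrite bernoulli_probE// !diracE EFinD !EFinM /unstable.onem.
Qed.

Lemma integral_two_point {R : realType} {d : measure_display}
    {T : measurableType d} (r : R) (a b : T) (f : T -> R) :
  0 <= r <= 1 -> measurable_fun setT f -> (forall z, 0 <= f z) ->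
  (\int[two_point r a b]_z (f z)%:E)%E = (r * f a + (1 - r) * f b)%:E.
Proof.
move=> r01 mf f0; rewrite ge0_integral_distribution; first last.
- by move=> z; rewrite lee_fin.
- exact/measurable_EFinP.
rewrite integral_bernoulli_prob//=.
by move=> z; rewrite lee_fin.
Qed.

Lemma measure_setD_null {R : realType} {d : measure_display}
    {T : measurableType d} (mu : {measure set T -> \bar R}) (A B : set T) :
  measurable A -> measurable B -> mu B = 0%E -> mu (A `\` B) = mu A.
Proof.
move=> mA mB B0; have AB0 : mu (A `&` B) = 0%E.
  by apply: measure_negligible; [exact: measurableI|exists B; split].
by rewrite -[LHS]adde0 -AB0; apply/esym; exact: measureDI.
Qed.

(** The masses of the two points add up to 1, so their complement is null. *)
Lemma two_point_unique {R : realType} {d : measure_display}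
    {T : measurableType d} (P : probability T R) (r : R) (a b : T) :
  measurable [set a] -> measurable [set b] -> a <> b -> 0 <= r <= 1 ->
  P [set a] = r%:E -> P [set b] = (1 - r)%:E ->
  forall A, measurable A -> P A = two_point r a b A.
Proof.
move=> ma mb ab r01 Pa Pb A mA; rewrite two_pointE//.
have mab : measurable ([set a] `|` [set b]) by exact: measurableU.
have dab (B : set T) : [set a] `&` B `&` ([set b] `&` B) = set0.
  by apply/seteqP; split => // z [[/= -> _] [/= /ab]].
have PU B : measurable B ->
    P (([set a] `|` [set b]) `&` B) = (r * \1_B a + (1 - r) * \1_B b)%:E.
  move=> mB; have PI (c : T) (s : R) : P [set c] = s%:E ->
      P ([set c] `&` B) = (s * \1_B c)%:E.
    move=> Pc; rewrite set1I indicE; case: ifPn => _; first by rewrite mulr1.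
    by rewrite mulr0 measure0.
  rewrite setIUl EFinD -(PI _ _ Pa) -(PI _ _ Pb).
  by apply: measureU; [exact: measurableI|exact: measurableI|exact: dab].
have Pab0 : P (~` ([set a] `|` [set b])) = 0%E.
  rewrite probability_setC// -[_ `|` _]setIT PU//.
  by rewrite !indicT/= !mulr1 -EFinB; congr (_%:E); lra.
rewrite -PU// -(measure_setD_null _ _ _ _ _ Pab0)//; last exact: measurableC.
by rewrite setDE setCK setIC.
Qed.

(** * Norm and transport cost *)

Lemma pnorm_coord {R : realType} (p : R) (z : R * R) : 0 < p ->
  - pnorm p z <= z.1 <= pnorm p z /\ - pnorm p z <= z.2 <= pnorm p z.
Proof.
move=> p0; have root (t s : R) : 0 <= t -> 0 <= s ->
    t <= (t `^ p + s `^ p) `^ p^-1.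
  move=> t0 s0; rewrite -[leLHS]powRr1// -[X in t `^ X](@divff _ p) ?gt_eqF//.
  rewrite powRrM ge0_ler_powR ?nnegrE ?invr_ge0 ?(ltW p0) ?powR_ge0//.
    by rewrite addr_ge0 ?powR_ge0.
  by rewrite lerDl powR_ge0.
by split; rewrite -ler_norml ?root// /pnorm addrC root.
Qed.

Lemma pnorm_axis2 {R : realType} (p t : R) : 0 < p -> pnorm p (0, t) = `|t|.
Proof.
move=> p0; rewrite /pnorm/= normr0 powR0 ?gt_eqF// add0r.
by rewrite -powRrM mulfV ?gt_eqF// powRr1.
Qed.

Lemma pnorm0 {R : realType} (p : R) : 0 < p -> pnorm p 0 = 0.
Proof. by move=> p0; rewrite (pnorm_axis2 p 0 p0) normr0. Qed.

Lemma measurable_pnorm {R : realType} (p : R) :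
  measurable_fun setT (pnorm p).
Proof.
have mpow (s : R) (f : R * R -> R) : measurable_fun setT f ->
    measurable_fun setT (fun z => f z `^ s).
  by move=> mf; exact: (measurableT_comp (measurable_powR s) mf).
apply: (mpow); apply: measurable_funD; apply: (mpow).
- exact: measurableT_comp (@normr_measurable _ setT) measurable_fst.
- exact: measurableT_comp (@normr_measurable _ setT) measurable_snd.
Qed.

Lemma measurable_dist {R : realType} (p : R) :
  measurable_fun setT
    (fun u : (R * R) * (R * R) => pnorm p (u.1 - u.2)).
Proof.
apply: (measurableT_comp (measurable_pnorm p)).
have m1 : measurable_fun setT (fun u : (R * R) * (R * R) => u.1).
  exact: measurable_fst.
have m2 : measurable_fun setT (fun u : (R * R) * (R * R) => u.2).
  exact: measurable_snd.
apply/measurable_fun_pairP; split; apply: measurable_funB.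
- exact: measurableT_comp measurable_fst m1.
- exact: measurableT_comp measurable_fst m2.
- exact: measurableT_comp measurable_snd m1.
- exact: measurableT_comp measurable_snd m2.
Qed.

Lemma coupling_integral {R : realType} (P1 P2 : {measure set (R * R) -> \bar R})
    (Q : probability ((R * R) * (R * R))%type R) (f : R * R -> R) :
  is_coupling P1 P2 Q -> measurable_fun setT f -> (forall z, 0 <= f z) ->
  (\int[Q]_u (f u.1)%:E = \int[P1]_z (f z)%:E)%E /\
  (\int[Q]_u (f u.2)%:E = \int[P2]_z (f z)%:E)%E.
Proof.
move=> cQ mf f0.
have mEf : measurable_fun setT (fun z => (f z)%:E) by exact/measurable_EFinP.
have Ef0 : {in setT, forall z, (0 <= (f z)%:E)%E}.
  by move=> z _; rewrite lee_fin.
split.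
- transitivity (\int[pushforward Q fst]_z (f z)%:E)%E.
    by rewrite ge0_integral_pushforward//; exact: measurable_fst.
  apply: eq_measure_integral => A mA _; rewrite -(cQ A mA).1.
  by rewrite /pushforward; congr (Q _); apply/seteqP; split => // u [].
- transitivity (\int[pushforward Q snd]_z (f z)%:E)%E.
    by rewrite ge0_integral_pushforward//; exact: measurable_snd.
  apply: eq_measure_integral => A mA _; rewrite -(cQ A mA).2.
  by rewrite /pushforward; congr (Q _); apply/seteqP; split => // u [].
Qed.

(** Integrating the inequality against any coupling bounds the first integral
    by the second plus the cost; couplings may only be near-optimal, which the
    slack [e] absorbs. *)
Lemma wasserstein_weak_duality {R : realType} (p theta : R)
    (P1 P2 : {measure set (R * R) -> \bar R}) (f g : R * R -> R) :
  measurable_fun setT f -> measurable_fun setT g ->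
  (forall z, 0 <= f z) -> (forall z, 0 <= g z) ->
  (forall u v, f u <= g v + pnorm p (u - v)) ->
  (wasserstein p P1 P2 <= theta%:E)%E ->
  (\int[P1]_z (f z)%:E <= \int[P2]_z (g z)%:E + theta%:E)%E.
Proof.
move=> mf mg f0 g0 fg W; apply/lee_addgt0Pr => e e0.
have /ereal_inf_lt[_ [Q cQ <-] Qlt] : (wasserstein p P1 P2 < (theta + e)%:E)%E.
  by rewrite (le_lt_trans W)// lte_fin ltrDl.
rewrite -addeA -EFinD -(coupling_integral _ _ _ _ cQ mf f0).1.
rewrite -(coupling_integral _ _ _ _ cQ mg g0).2.
apply: le_trans (leeD2l _ (ltW Qlt)).
have norm0 z : 0 <= pnorm p z by exact: powR_ge0.
rewrite -ge0_integralD//=.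
- apply: ge0_le_integral => //=.
  + by move=> u _; rewrite lee_fin.
  + by apply/measurable_EFinP; exact: measurableT_comp mf measurable_fst.
  + apply: emeasurable_funD; apply/measurable_EFinP.
      exact: measurableT_comp mg measurable_snd.
    exact: measurable_dist.
  + by move=> u _; rewrite -EFinD lee_fin.
- by move=> u _; rewrite lee_fin.
- by apply/measurable_EFinP; exact: measurableT_comp mg measurable_snd.
- by move=> u _; rewrite lee_fin.
- by apply/measurable_EFinP; exact: measurable_dist.
Qed.

(** The coupling matches [a] with [a'] and [b] with [b']. *)
Lemma wasserstein_two_point_le {R : realType} (p r : R)
    (P2 : {measure set (R * R) -> \bar R}) (a a' b b' : R * R) : 0 <= r <= 1 ->
  (forall A, measurable A -> P2 A = two_point r a' b' A) ->
  (wasserstein p (two_point r a b) P2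
   <= (r * pnorm p (a - a') + (1 - r) * pnorm p (b - b'))%:E)%E.
Proof.
move=> r01 eqP2; apply: ge_ereal_inf.
exists (\int[two_point r (a, a') (b, b')]_u (pnorm p (u.1 - u.2))%:E)%E;
  last first.
  rewrite integral_two_point//; first exact: measurable_dist.
  by move=> u; exact: powR_ge0.
exists (two_point r (a, a') (b, b')) => // A mA.
rewrite eqP2//; split; apply: (congr1 (bernoulli_prob r)).
all: by apply/seteqP; split => -[] // -[].
Qed.

(** * The chance constraint and the ALSO-X approximation *)

Definition bad_pt {R : realType} : R * R := (1, -1).
Definition good_pt {R : realType} : R * R := (-1, 1).

(** The violating region at [x = 0], the only point that ALSO-X proposes. *)
Definition star_bad {R : realType} : set (R * R) := [set z | 0 <= star_g 0 z].

Lemma measurable_pt {R : realType} (z : R * R) : measurable [set z].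
Proof.
case: z => x y; have -> : [set (x, y)] = [set x] `*` [set y].
  by apply/seteqP; split => [_ -> //|[u v] [/= -> ->]].
exact: measurableX. Qed.

(** Weak duality for two indicator functions: the part of [P1] in [V] either
    comes from outside [c], or has moved from [c] by at least 1. *)
Lemma wasserstein_prob_le {R : realType} (p theta : R)
    (P1 P2 : {measure set (R * R) -> \bar R}) (V : set (R * R)) (c : R * R) :
  measurable V -> (forall u, V u -> 1 <= pnorm p (u - c)) ->
  (wasserstein p P1 P2 <= theta%:E)%E ->
  (P1 V <= P2 (~` [set c]) + theta%:E)%E.
Proof.
move=> mV far W.
have mc : measurable (~` [set c]) by apply: measurableC; exact: measurable_pt.
rewrite -[V]setIT -[~` _]setIT -!integral_indic//.
apply: wasserstein_weak_duality W => //.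
move=> u v; rewrite !indicE.
have norm0 : 0 <= pnorm p (u - v) by exact: powR_ge0.
have [vc|vc] := pselect (v = c); last first.
  by rewrite [v \in _]mem_set//= ler_wpDr//; case: (u \in V).
rewrite [v \in _]memNset ?add0r; last by move=> /(_ vc).
have [uV|uV] := boolP (u \in V); last by [].
by rewrite vc far//; exact: set_mem.
Qed.

Lemma measurable_star_g {R : realType} (x : R) : measurable_fun setT (star_g x).
Proof.
by apply: measurable_maxr; apply: measurable_funB.
Qed.

Lemma measurable_star_bad {R : realType} : measurable (@star_bad R).
Proof.
rewrite -[star_bad]setTI.
have -> : star_bad = star_g (0 : R) @^-1` `[0, +oo[.
  by apply/seteqP; split => z /=; rewrite in_itv/= andbT.
exact: measurable_star_g.
Qed.

Lemma star_goodE {R : realType} :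
  [set z : R * R | z.1 < 0 /\ 0 < z.2] = ~` star_bad.
Proof.
rewrite /star_bad /star_g; apply/seteqP; split => z /=.
  by move=> [z1 z2]; apply/negP; rewrite le_max; lra.
by move=> /negP; rewrite le_max => ?; split; lra.
Qed.

Lemma star_bad_far {R : realType} (p : R) (u : R * R) : 0 < p ->
  star_bad u -> 1 <= pnorm p (u - good_pt).
Proof.
move=> p0; rewrite /star_bad /star_g/= le_max.
by have := pnorm_coord p (u - good_pt) p0; rewrite /=; lra.
Qed.

Lemma star_loss_lipschitz {R : realType} (p x : R) (u v : R * R) : 0 < p ->
  Num.max (star_g x u) 0 <= Num.max (star_g x v) 0 + pnorm p (u - v).
Proof.
move=> p0; have /= uv := pnorm_coord p (u - v) p0.
set M := Num.max (star_g x v) 0.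
have M0 : 0 <= M by rewrite le_max lexx orbT.
have Mg : star_g x v <= M by rewrite le_max lexx.
move: Mg; rewrite {1}/star_g ge_max => ?.
by rewrite /star_g !ge_max; lra.
Qed.

(** The nonempty regions are those with [delta >= 0] and all of them contain 0,
    so every selection is constantly 0 on them; hence the smallest accepted
    [delta] is 0. *)
Lemma alsox_exact_of_strict_min {R : realType} (eps : R)
    (F : set (probability (R * R)%type R)) :
  (forall x, 0 < x <= 1 ->
     (alsox_objective F star_g 0 < alsox_objective F star_g x)%E) ->
  (worst_prob F star_bad <= eps%:E)%E ->
  star_alsox_exact eps F.
Proof.
move=> min0 prob0; set obj := alsox_objective F star_g.
have min0_le x : 0 <= x <= 1 -> (obj 0%R <= obj x)%E.
  move=> /andP[]; rewrite le_eqVlt => /predU1P[<-//|x0 x1].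
  by apply/ltW/min0; rewrite x0.
pose region := alsox_region [set x : R | 0 <= x <= 1] 1.
have region0 delta : region delta !=set0 <-> 0 <= delta.
  split => [[x [/= /andP[x0 _]]]|d0]; rewrite ?mul1r; first exact: le_trans.
  by exists 0; split; rewrite /= ?mul1r ?lexx ?ler01.
have region_0 delta : 0 <= delta -> region delta 0.
  by move=> d0; split; rewrite /= ?mul1r ?lexx ?ler01.
split.
  exists (fun=> 0) => delta /region0 d0; split; first exact: region_0.
  by move=> y [/= y01 _]; exact: min0_le.
move=> xs sel.
have xs0 delta : 0 <= delta -> xs delta = 0.
  move=> d0; have [[/= /andP[x0 x1] _] xmin] := sel _ ((region0 _).2 d0).
  apply/eqP/contraT => xn0; have := xmin _ (region_0 _ d0).
  by rewrite leNgt min0// lt_neqAle eq_sym xn0 x0.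
exists 0; split.
  exists 0; split; last by rewrite xs0.
  split; last by move=> y [/region0].
  by split; [exact/region0|rewrite xs0].
split; last by move=> y [/andP[]].
split; first by rewrite lexx ler01.
move=> P FP; rewrite star_goodE probability_setC;
  last exact: measurable_star_bad.
rewrite EFinB; apply: leeB => //; apply: le_trans prob0.
by apply: ereal_sup_ubound; exists P.
Qed.

(** The worst-case loss at 0 is at most [r + theta] by weak duality, while at
    [x > 0] the distribution that pushes the bad point away from the feasible
    region, at total cost [theta], has the larger loss [r (1 + x) + theta]. *)
Lemma star_alsox_exact_near_two_point {R : realType} (p r theta eps : R)
    (m : {measure set (R * R) -> \bar R}) :
  0 < p -> 0 < r <= 1 -> 0 <= theta -> r + theta <= eps ->
  (forall A, measurable A -> m A = two_point r bad_pt good_pt A) ->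
  star_alsox_exact eps
    [set P : probability (R * R)%type R | (wasserstein p P m <= theta%:E)%E].
Proof.
move=> p0 /andP[r0 r1] th0 rth mE.
have r01 : 0 <= r <= 1 by rewrite ltW.
pose loss (x : R) z := Num.max (star_g x z) 0.
have mloss x : measurable_fun setT (loss x).
  by apply: measurable_maxr => //; exact: measurable_star_g.
have loss0 x z : 0 <= loss x z by rewrite le_max lexx orbT.
have loss_bad (x t : R) : 0 <= x -> 0 <= t -> loss x (1, -1 - t) = 1 + x + t.
  by move=> x0 t0; rewrite /loss /star_g/= !maxEle; do !case: ifP; lra.
have loss_good (x : R) : 0 <= x <= 1 -> loss x good_pt = 0.
  by move=> x01; rewrite /loss /star_g/= !maxEle; do !case: ifP; lra.
have int_m (f : R * R -> R) : measurable_fun setT f -> (forall z, 0 <= f z) ->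
    (\int[m]_z (f z)%:E = (r * f bad_pt + (1 - r) * f good_pt)%:E)%E.
  move=> mf f0; rewrite -integral_two_point//.
  by apply: eq_measure_integral => A mA _; exact: mE.
apply: alsox_exact_of_strict_min => [x /andP[x0 x1]|]; last first.
  apply: ge_ereal_sup => _ [P WP <-].
  apply: le_trans (wasserstein_prob_le _ _ P _ _ _ measurable_star_bad _ WP) _.
    by move=> u; exact: star_bad_far.
  rewrite mE ?two_pointE//; last by apply: measurableC; exact: measurable_pt.
  rewrite !indicE [bad_pt \in _]mem_set/=; last by move=> [?]; lra.
  rewrite [good_pt \in _]memNset/=; last exact.
  by rewrite -EFinD lee_fin; lra.
apply: (@le_lt_trans _ _ (r + theta)%:E).
  apply: ge_ereal_sup => _ [P WP <-].
  have := wasserstein_weak_duality _ _ _ _ _ _ (mloss 0) (mloss 0)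
    (loss0 0) (loss0 0) (fun u v => star_loss_lipschitz _ 0 u v p0) WP.
  move=> /le_trans; apply; rewrite int_m// loss_good ?lexx ?ler01//.
  have := loss_bad 0 0 (lexx _) (lexx _); rewrite subr0 => ->.
  by rewrite -EFinD lee_fin; lra.
apply: (@lt_le_trans _ _ (r * (1 + x) + theta)%:E).
  by rewrite lte_fin; nra.
apply: le_ereal_sup_tmp.
(* The mass [r] may move by [theta / r]; along the second axis, downwards, the
   loss grows at unit rate. *)
pose worst_pt : R * R := (1, -1 - theta / r).
exists (\int[two_point r worst_pt good_pt]_z (loss x z)%:E)%E.
  exists (two_point r worst_pt good_pt) => //=.
  apply: le_trans (wasserstein_two_point_le _ _ _ _ _ _ _ r01 mE) _.
  have -> : worst_pt - bad_pt = (0, - (theta / r)) by congr pair => /=; lra.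
  rewrite subrr pnorm0// pnorm_axis2// normrN ger0_norm ?divr_ge0 ?(ltW r0)//.
  by rewrite mulr0 addr0 mulrC divfK ?gt_eqF.
rewrite integral_two_point// loss_good ?(ltW x0)//.
rewrite loss_bad ?(ltW x0) ?divr_ge0 ?(ltW r0)// lee_fin mulr0 addr0.
by rewrite [in leRHS]mulrDr [r * (theta / r)]mulrC divfK ?gt_eqF ?mulrDr.
Qed.

(** * The CVaR approximation *)

(** For every [tau], bound [max (l a - tau) 0] by [l a - tau] with full weight
    [r], and [max (l b - tau) 0] by [l b - tau] with weight [eps - r] only:
    the weights then sum to [eps] and [tau] cancels. *)
Lemma cvar_two_point_ge {R : realType} (eps r : R) (a b : R * R)
    (P : probability (R * R)%type R) (l : R * R -> R) :
  0 < eps <= 1 -> 0 <= r <= eps -> measurable_fun setT l ->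
  (forall A, measurable A -> P A = two_point r a b A) ->
  (((r * l a + (eps - r) * l b) / eps)%:E <= cvar eps P l)%E.
Proof.
move=> /andP[e0 e1] /andP[r0 re] ml PE.
have r01 : 0 <= r <= 1 by rewrite r0 (le_trans re).
apply/ereal_infP => _ [tau _ <-].
set h := fun z => Num.max (l z - tau) 0.
have h0 z : 0 <= h z by rewrite le_max lexx orbT.
have hl z : l z - tau <= h z by rewrite le_max lexx.
have mh : measurable_fun setT h.
  by apply: measurable_maxr => //; exact: measurable_funB.
have -> : (\int[P]_z (h z)%:E)%E = (r * h a + (1 - r) * h b)%:E.
  rewrite -integral_two_point//.
  by apply: eq_measure_integral => A mA _; exact: PE.
rewrite -EFinM -EFinD lee_fin ler_pdivrMr// [leRHS]mulrDl divfK ?gt_eqF//.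
have ha := ler_wpM2l r0 (hl a).
have er0 : 0 <= eps - r by lra.
have hb := ler_wpM2l er0 (hl b).
have hb' : 0 <= (1 - eps) * h b by rewrite mulr_ge0//; lra.
nra.
Qed.

Lemma star_cvar_infeasible {R : realType} (eps rho : R) (w : R * R)
    (F : set (probability (R * R)%type R)) (P : probability (R * R)%type R) :
  0 < eps < 1 -> eps / 2 < rho < eps ->
  (forall A, measurable A -> P A = two_point rho bad_pt good_pt A) ->
  F P -> simplex2pp w -> star_cvar_feasible eps F w = set0.
Proof.
move=> /andP[e0 e1] /andP[rho_gt rho_lt] PE FP [/andP[w10 _] /andP[w20 _] _].
apply/seteqP; split => // x [/andP[x0 x1]]; apply/negP; rewrite -ltNge.
set l := fun z : R * R => Num.max (w.1 * (z.1 - x)) (w.2 * (x - z.2)).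
have ml : measurable_fun setT l.
  apply: measurable_maxr; apply: measurable_funM => //.
    exact: measurable_funB.
  exact: measurable_funB.
apply: (@lt_le_trans _ _ (cvar eps P l)); last first.
  by apply: ereal_sup_ubound; exists P.
apply: lt_le_trans (cvar_two_point_ge eps rho _ _ _ _ _ _ ml PE); last first.
- by rewrite (ltW rho_lt) andbT; lra.
- by rewrite e0 ltW.
rewrite lte_fin divr_gt0//.
have l_bad : w.2 * (1 + x) <= l bad_pt.
  by rewrite le_max; apply/orP; right; rewrite /= opprK addrC.
have l_good : - (w.2 * (1 - x)) <= l good_pt.
  by rewrite le_max; apply/orP; right; rewrite /= -mulrN opprB.
have rho0 : 0 <= rho by lra.
have er0 : 0 <= eps - rho by lra.
have := ler_wpM2l rho0 l_bad; have := ler_wpM2l er0 l_good.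
have : 0 < w.2 * (2 * rho - eps) by rewrite mulr_gt0//; lra.
have : 0 <= w.2 * x * eps by rewrite !mulr_ge0// ltW.
nra.
Qed.

(** * Sampling *)

Lemma empirical_two_point {R : realType} (x : nat -> R * R) (N : nat)
    (a b : R * R) : (0 < N)%N -> (forall i, x i = a \/ x i = b) ->
  exists2 r : R, 0 <= r <= 1 &
    forall A, measurable A -> empirical x N A = two_point r a b A.
Proof.
move=> N0 xab.
have N0R : 0 < N%:R :> R by rewrite ltr0n.
pose k : R := \sum_(i < N) (x i == a)%:R.
have kN : k <= N%:R.
  suff : k <= \sum_(i < N) 1 by rewrite sumr_const card_ord.
  by apply: ler_sum => i _; case: eqP.
have r01 : 0 <= k / N%:R <= 1.
  by rewrite divr_ge0 ?sumr_ge0 ?(ltW N0R)//= ler_pdivrMr// mul1r.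
exists (k / N%:R) => // A mA; rewrite two_pointE//.
have -> : empirical x N A = (N%:R^-1 * \sum_(i < N) \1_A (x i))%:E.
  by rewrite /empirical/= /mscale/= /msum EFinM -sumEFin; congr (_ * _)%E.
have -> : \sum_(i < N) \1_A (x i) = k * \1_A a + (N%:R - k) * \1_A b.
  have -> : N%:R - k = \sum_(i < N) (1 - (x i == a)%:R).
    by rewrite sumrB sumr_const card_ord.
  rewrite !mulr_suml -big_split/=; apply: eq_bigr => i _.
  have [->|/eqP xia] := eqVneq (x i) a.
    by rewrite subrr mul1r mul0r addr0.
  by case: (xab i) => // ->; rewrite subr0 mul1r mul0r add0r.
by congr (_%:E); field; rewrite gt_eqF.
Qed.

(** Removing a null set from the events, and replacing finitely many of them
    by the empty event, does not change the limit. *)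
Lemma with_prob_to_1_sub {R : realType} {d : measure_display}
    {Omega : measurableType d} (Pr : probability Omega R)
    (A B : nat -> set Omega) (S : set Omega) :
  {ae Pr, forall om, S om} ->
  (\forall N \near \oo, A N `&` S `<=` B N) ->
  with_prob_to_1 Pr A -> with_prob_to_1 Pr B.
Proof.
move=> [Z [mZ Z0 SZ]] AB [E [mE EA PrE]].
(* Whether [N] is past the threshold does not depend on the sample, so the
   case distinction keeps the events measurable. *)
exists (fun N => if `[< A N `&` S `<=` B N >] then E N `\` Z else set0); split.
- by move=> N; case: ifP => // _; exact: measurableD.
- move=> N om; case: asboolP => // AS [Eom Zom]; apply: AS.
  split; first exact: EA.
  by apply: contrapT => /SZ.
- move: PrE; apply: cvg_trans; apply: near_eq_cvg; near=> N.
  rewrite asboolT; first by apply/esym; exact: measure_setD_null.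
  by near: N.
Unshelve. all: by end_near. Qed.

Lemma iid_ae_support {R : realType} {d d' : measure_display}
    {Omega : measurableType d} {T : measurableType d'}
    (Pr : probability Omega R) (P0 : probability T R)
    (xi : nat -> {mfun Omega >-> T}) (S : set T) :
  iid_samples Pr P0 xi -> measurable S -> P0 (~` S) = 0%E ->
  {ae Pr, forall om, forall i, S (xi i om)}.
Proof.
move=> [law _] mS S0; apply: ae_foralln => i.
exists (xi i @^-1` (~` S)); split => //.
- rewrite -[_ @^-1` _]setTI; apply: measurable_funPT => //.
  exact: measurableC.
- by rewrite -S0 -(law i)//; exact: measurableC.
Qed.

Theorem proposition15 (R : realType) (eps rho : R) (p : rat)
    (d : measure_display) (Omega : measurableType d) (Pr : probability Omega R)
    (P0 : probability (R * R)%type R)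
    (xi : nat -> {mfun Omega >-> (R * R)%type})
    (theta : nat -> R)
    (eps01 : 0 < eps < 1)
    (p_gt1 : 1 < p)
    (rho_bounds : eps / 2 < rho < eps)
    (P0_pos : P0 [set (1, -1)] = rho%:E)
    (P0_neg : P0 [set (-1, 1)] = (1 - rho)%:E)
    (xi_iid : iid_samples Pr P0 xi)
    (theta_gt0 : forall N : nat, (0 < N)%N -> 0 < theta N)
    (theta_cvg0 : theta N @[N --> \oo] --> 0)
    (P0_in_ball : with_prob_to_1 Pr (fun N => [set om |
       ambiguity_set (ratr p) (fun i => xi i om) N (theta N) P0])) :
  with_prob_to_1 Pr (fun N => [set om |
    star_alsox_exact eps
      (ambiguity_set (ratr p) (fun i => xi i om) N (theta N))]) /\
  with_prob_to_1 Pr (fun N => [set om |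
    forall w : R * R, simplex2pp w ->
      star_cvar_feasible eps
        (ambiguity_set (ratr p) (fun i => xi i om) N (theta N)) w = set0]).
Proof.
have p0 : 0 < ratr p :> R by rewrite ltr0q (lt_trans _ p_gt1).
have rho01 : 0 <= rho <= 1 by lra.
have bad_good : bad_pt <> good_pt :> R * R by case=> ?; lra.
have P0E := two_point_unique P0 rho _ _ (measurable_pt bad_pt)
  (measurable_pt good_pt) bad_good rho01 P0_pos P0_neg.
have mS : measurable ([set bad_pt] `|` [set good_pt] : set (R * R)).
  by apply: measurableU; exact: measurable_pt.
have P0S : P0 (~` ([set bad_pt] `|` [set good_pt])) = 0%E.
  rewrite P0E ?two_pointE//; last exact: measurableC.
  rewrite !indicE !memNset ?mulr0 ?addr0//.
    by move=> /=; apply; right.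
  by move=> /=; apply; left.
have support := iid_ae_support _ _ _ _ xi_iid mS P0S.
split; apply: with_prob_to_1_sub P0_in_ball; [exact: support| |exact: support|].
  (* [theta < rho / 2] keeps [r >= rho - theta] positive, and
     [theta < (eps - rho) / 2] gives [r + theta <= rho + 2 theta <= eps]. *)
  have theta_small : \forall N \near \oo,
      theta N < Num.min (rho / 2) ((eps - rho) / 2).
    apply: (cvgr_lt 0) => //; rewrite lt_min; lra.
  near=> N => om [/= inF supp].
  have : theta N < Num.min (rho / 2) ((eps - rho) / 2) by near: N.
  rewrite lt_min => /andP[th1 th2].
  have N0 : (0 < N)%N by near: N; exact: nbhs_infty_gt.
  have [r /andP[r0 r1] mE] :=
    empirical_two_point (fun i => xi i om) N _ _ N0 supp.
  have mV (c : R * R) : measurable (~` [set c]).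
    by apply: measurableC; exact: measurable_pt.
  have far_good (u : R * R) :
      [set bad_pt] u -> 1 <= pnorm (ratr p) (u - good_pt).
    move=> ->; apply: star_bad_far => //.
    by rewrite /star_bad /star_g/= le_max; lra.
  have far_bad (u : R * R) :
      [set good_pt] u -> 1 <= pnorm (ratr p) (u - bad_pt).
    by move=> ->; have /= := pnorm_coord (ratr p) (good_pt - bad_pt) p0; lra.
  have : (rho%:E <= empirical (fun i => xi i om) N (~` [set good_pt])
      + (theta N)%:E)%E.
    rewrite -P0_pos.
    by apply: wasserstein_prob_le (measurable_pt _) far_good inF.
  have : ((1 - rho)%:E <= empirical (fun i => xi i om) N (~` [set bad_pt])
      + (theta N)%:E)%E.
    rewrite -P0_neg.
    by apply: wasserstein_prob_le (measurable_pt _) far_bad inF.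
  rewrite !mE// !two_pointE ?r0// !indicE.
  rewrite [bad_pt \in [set~ good_pt]]mem_set//=.
  rewrite [good_pt \in [set~ bad_pt]]mem_set/=; last exact/nesym.
  rewrite [bad_pt \in _]memNset/=; last exact.
  rewrite [good_pt \in _]memNset/=; last exact.
  rewrite -!EFinD !lee_fin => hgood hbad.
  by apply: (star_alsox_exact_near_two_point _ r) mE => //;
    rewrite ?r1 ?andbT; lra.
exists 0%N => // N _ om [/= inF _] w sw.
exact: (star_cvar_infeasible eps rho w _ P0).
Unshelve. all: by end_near. Qed.
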